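(* The Lipschitz-free spaces $\mathcal F\big((\bigoplus_{2^{\omega}}\ell_\infty)_{c_0}\big)$ and $\mathcal F(\ell_\infty)$ are linearly isomorphic (as Banach spaces).
   Context: For a metric space $M$ with distinguished base point $0$ (the origin if $M$ is a Banach space), $\operatorname{Lip}_0(M)$ is the Banach space of real-valued Lipschitz functions $f$ on $M$ with $f(0)=0$, normed by the best Lipschitz constant; for $x\in M$, $\delta(x)\in \operatorname{Lip}_0(M)^*$ is evaluation at $x$; and $\mathcal F(M)=\overline{\operatorname{span}}\{\delta(x):x\in M\}\subset \operatorname{Lip}_0(M)^*$ is the Lipschitz-free space. $2^\omega$ is the cardinality of the continuum. $(\bigoplus_{2^{\omega}}\ell_\infty)_{c_0}$ is the $c_0$-sum of $2^\omega$ many copies of $\ell_\infty=\ell_\infty(\mathbb N)$: families $(x_t)_{t\in 2^\omega}$ in $\ell_\infty$ such that $\{t:\|x_t\|\geq\varepsilon\}$ is finite for every $\varepsilon>0$, with norm $\sup_t\|x_t\|$. *)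

(* Defs.v *)
From HB Require Import structures.
From mathcomp Require Import all_boot all_order all_algebra.
From mathcomp Require Import all_classical all_reals all_analysis.

Set Implicit Arguments.
Unset Strict Implicit.
Unset Printing Implicit Defensive.

Import Order.TTheory GRing.Theory Num.Theory.
Import numFieldNormedType.Exports.

Local Open Scope classical_set_scope.
Local Open Scope ring_scope.

Section sup_norm.
Context {R : realType} {T : Type} {V : normedModType R}.
Implicit Types (S : set T) (f g : T -> V).

Definition bounded_over S f := exists C : R, forall x, S x -> `|f x| <= C.

(* Only meaningful when [bounded_over S f]; [sup set0 = 0] and so
   [sup_norm set0 f = 0]. *)
Definition sup_norm S f : R := sup [set `|f x| | x in S].

Lemma sup_norm_ub S f x : bounded_over S f -> S x -> `|f x| <= sup_norm S f.
Proof.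
move=> [C fC] Sx; apply: ub_le_sup; last by exists x.
by exists C => _ [y Sy <-]; exact: fC.
Qed.

Lemma sup_norm_ge0 S f : 0 <= sup_norm S f.
Proof.
rewrite /sup_norm; set E := [set _ | _ in _].
have [[[_ [x Sx _]] ub]|nE] := pselect (has_sup E); last by rewrite sup_out.
by rewrite (le_trans (normr_ge0 (f x)))// ub_le_sup//; exists x.
Qed.

Lemma sup_norm_le S f C :
  0 <= C -> (forall x, S x -> `|f x| <= C) -> sup_norm S f <= C.
Proof.
move=> C0 fC; have [->|/set0P[x Sx]] := eqVneq S set0.
  by rewrite /sup_norm image_set0 sup0.
apply: ge_sup; first by exists `|f x|, x.
by move=> _ [y Sy <-]; exact: fC.
Qed.

Lemma sup_normD S f g : bounded_over S f -> bounded_over S g ->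
  sup_norm S (f + g) <= sup_norm S f + sup_norm S g.
Proof.
move=> bf bg; apply: sup_norm_le; first by rewrite addr_ge0 ?sup_norm_ge0.
move=> x Sx; rewrite (le_trans (ler_normD _ _))// lerD//.
  exact: sup_norm_ub.
exact: sup_norm_ub.
Qed.

Lemma bounded_over0 S : bounded_over S 0.
Proof. by exists 0 => x _; rewrite normr0. Qed.

Lemma bounded_overD S f g :
  bounded_over S f -> bounded_over S g -> bounded_over S (f + g).
Proof.
move=> bf bg; exists (sup_norm S f + sup_norm S g) => x Sx.
by rewrite (le_trans (ler_normD _ _))// lerD// sup_norm_ub.
Qed.

Lemma bounded_overZ S a f : bounded_over S f -> bounded_over S (a *: f).
Proof.
move=> bf; exists (`|a| * sup_norm S f) => x Sx.
by rewrite normrZ ler_wpM2l// sup_norm_ub.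
Qed.

Lemma sup_normZ_le S a f :
  bounded_over S f -> sup_norm S (a *: f) <= `|a| * sup_norm S f.
Proof.
move=> bf; apply: sup_norm_le; first by rewrite mulr_ge0 ?sup_norm_ge0.
by move=> x Sx; rewrite normrZ ler_wpM2l// sup_norm_ub.
Qed.

Lemma sup_normZ S a f :
  bounded_over S f -> sup_norm S (a *: f) = `|a| * sup_norm S f.
Proof.
move=> bf; apply/eqP; rewrite eq_le sup_normZ_le//=.
have [->|a0] := eqVneq a 0; first by rewrite normr0 mul0r sup_norm_ge0.
rewrite -ler_pdivlMl ?normr_gt0// -normfV.
rewrite (le_trans _ (sup_normZ_le _ _))//; last exact: bounded_overZ.
by rewrite scalerA mulVf// scale1r.
Qed.

Lemma sup_norm_eq0 S f x :
  bounded_over S f -> sup_norm S f = 0 -> S x -> f x = 0.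
Proof.
by move=> bf f0 Sx; apply/eqP; rewrite -normr_le0 -f0 sup_norm_ub.
Qed.

End sup_norm.

Section normed_metric.
Context {R : realType} {V : normedModType R}.

Definition norm_dist (x y : V) : R := `|x - y|.

Lemma norm_dist_ge0 x y : 0 <= norm_dist x y.
Proof. exact: normr_ge0. Qed.

Lemma norm_dist_positivity x y : norm_dist x y = 0 -> x = y.
Proof. by move=> /normr0_eq0/eqP; rewrite subr_eq0 => /eqP. Qed.

Lemma norm_dist_ball x (e : R) : ball x e = [set y | norm_dist x y < e].
Proof. by rewrite -ball_normE. Qed.

End normed_metric.

Section ell_infty.
Context (R : realType).

Definition ell_infty_pred : {pred nat -> R} :=
  fun x => `[< bounded_over [set: nat] x >].

Record ell_infty := EllInfty {
  ell_infty_val :> nat -> R ;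
  _ : ell_infty_val \in ell_infty_pred }.

HB.instance Definition _ := [isSub for ell_infty_val].
HB.instance Definition _ := [Choice of ell_infty by <:].

Lemma ell_inftyP (x : ell_infty) : bounded_over [set: nat] x.
Proof. by apply/asboolP; exact: (valP x). Qed.

Fact ell_infty_submod_closed : subsemimod_closed ell_infty_pred.
Proof.
split; first split.
- by apply/asboolP; exact: bounded_over0.
- by move=> x y /asboolP ? /asboolP ?; apply/asboolP; exact: bounded_overD.
- by move=> a x /asboolP ?; apply/asboolP; exact: bounded_overZ.
Qed.

HB.instance Definition _ := GRing.SubChoice_isSubLmodule.Build
  R (nat -> R) ell_infty_pred ell_infty ell_infty_submod_closed.

Definition ell_infty_norm (x : ell_infty) : R := sup_norm [set: nat] x.

Fact ell_infty_normD x y :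
  ell_infty_norm (x + y) <= ell_infty_norm x + ell_infty_norm y.
Proof. by apply: sup_normD; exact: ell_inftyP. Qed.

Fact ell_infty_normZ a x : ell_infty_norm (a *: x) = `|a| * ell_infty_norm x.
Proof. by apply: sup_normZ; exact: ell_inftyP. Qed.

Fact ell_infty_norm_eq0 x : ell_infty_norm x = 0 -> x = 0.
Proof.
move=> x0; apply/val_inj/funext => n.
by apply: sup_norm_eq0 x0 _ => //; exact: ell_inftyP.
Qed.

HB.instance Definition _ := Lmodule_isNormed.Build R ell_infty
  ell_infty_normD ell_infty_normZ ell_infty_norm_eq0.

HB.instance Definition _ := PseudoMetric_isMetric.Build R ell_infty
  norm_dist_ge0 norm_dist_positivity norm_dist_ball.

End ell_infty.

Section c0_sum.
Context {R : realType} (I : Type) (V : normedModType R).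

Definition c0_sum_pred : {pred I -> V} :=
  fun x => `[< forall e : R, 0 < e -> finite_set [set t | e <= `|x t|] >].

Record c0_sum := C0Sum {
  c0_sum_val :> I -> V ;
  _ : c0_sum_val \in c0_sum_pred }.

HB.instance Definition _ := [isSub for c0_sum_val].
HB.instance Definition _ := [Choice of c0_sum by <:].

Lemma c0_sumP (x : c0_sum) (e : R) :
  0 < e -> finite_set [set t | e <= `|x t|].
Proof. by move: e; apply/asboolP; exact: (valP x). Qed.

Fact c0_sum_submod_closed : subsemimod_closed c0_sum_pred.
Proof.
split; first split.
- apply/asboolP => e e0; rewrite (_ : mkset _ = set0)//.
  by apply/seteqP; split => // t /=; rewrite normr0 leNgt e0.
- move=> x y /asboolP xP /asboolP yP; apply/asboolP => e e0.
  have e20 : 0 < e / 2 by rewrite divr_gt0.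
  apply: (@sub_finite_set _ _ ([set t | e / 2 <= `|x t|] `|`
                               [set t | e / 2 <= `|y t|])).
    move=> t /= ext; have [|xt] := leP (e / 2) `|x t|; first by left.
    right; rewrite leNgt; apply/negP => yt.
    by move: ext; rewrite leNgt (le_lt_trans (ler_normD _ _))// [e]splitr ltrD.
  by rewrite finite_setU; split; [exact: xP|exact: yP].
- move=> a x /asboolP xP; apply/asboolP => e e0.
  have [->|a0] := eqVneq a 0.
    rewrite (_ : mkset _ = set0)//; apply/seteqP; split => // t /=.
    by rewrite scale0r normr0 leNgt e0.
  rewrite (_ : mkset _ = [set t | e / `|a| <= `|x t|]).
    by apply: xP; rewrite divr_gt0// normr_gt0.
  apply/seteqP; split => t /=; rewrite normrZ ler_pdivrMr ?normr_gt0//;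
    by rewrite mulrC.
Qed.

HB.instance Definition _ := GRing.SubChoice_isSubLmodule.Build
  R (I -> V) c0_sum_pred c0_sum c0_sum_submod_closed.

Lemma c0_sum_bounded (x : c0_sum) : bounded_over [set: I] x.
Proof.
have /finite_fsetP[A xA] : finite_set [set `|x t| | t in [set t | 1 <= `|x t|]].
  by apply: finite_image; exact: c0_sumP.
exists (1 + \sum_(r <- finmap.enum_fset A) `|r|) => t _.
have [xt|xt] := leP 1 `|x t|; last first.
  by rewrite (le_trans (ltW xt))// lerDl sumr_ge0.
have tA : `|x t| \in finmap.enum_fset A.
  by have : [set `|x t| | t in [set t | 1 <= `|x t|]] `|x t|;
    [exists t|rewrite xA].
by rewrite (big_rem _ tA)/= normr_id addrCA lerDl addr_ge0// sumr_ge0.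
Qed.

Definition c0_sum_norm (x : c0_sum) : R := sup_norm [set: I] x.

Fact c0_sum_normD x y : c0_sum_norm (x + y) <= c0_sum_norm x + c0_sum_norm y.
Proof. by apply: sup_normD; exact: c0_sum_bounded. Qed.

Fact c0_sum_normZ a x : c0_sum_norm (a *: x) = `|a| * c0_sum_norm x.
Proof. by apply: sup_normZ; exact: c0_sum_bounded. Qed.

Fact c0_sum_norm_eq0 x : c0_sum_norm x = 0 -> x = 0.
Proof.
move=> x0; apply/val_inj/funext => t.
by apply: sup_norm_eq0 x0 _ => //; exact: c0_sum_bounded.
Qed.

HB.instance Definition _ := Lmodule_isNormed.Build R c0_sum
  c0_sum_normD c0_sum_normZ c0_sum_norm_eq0.

HB.instance Definition _ := PseudoMetric_isMetric.Build R c0_sum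
  norm_dist_ge0 norm_dist_positivity norm_dist_ball.

End c0_sum.

Section Lip0.
Context {R : realType} (M : metricType R) (x0 : M).
Implicit Type f : M -> R.

(* The library's [k.-lipschitz f] requires the domain to be a normed space. *)
Definition lipschitz_const (L : R) f :=
  0 <= L /\ forall x y, `|f x - f y| <= L * mdist x y.

Definition Lip0_pred : {pred M -> R} :=
  fun f => `[< f x0 = 0 /\ exists L, lipschitz_const L f >].

Record Lip0 := MkLip0 {
  Lip0_val :> M -> R ;
  _ : Lip0_val \in Lip0_pred }.

HB.instance Definition _ := [isSub for Lip0_val].
HB.instance Definition _ := [Choice of Lip0 by <:].

Lemma Lip0_base (f : Lip0) : f x0 = 0.
Proof. by have /asboolP[] := valP f. Qed.

Lemma Lip0_lipschitz (f : Lip0) : exists L, lipschitz_const L f.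
Proof. by have /asboolP[] := valP f. Qed.

Lemma lipschitz_constD L K f g :
  lipschitz_const L f -> lipschitz_const K g -> lipschitz_const (L + K) (f + g).
Proof.
move=> [L0 fL] [K0 gK]; split; first exact: addr_ge0.
move=> x y; rewrite addrfctE.
by rewrite opprD addrACA mulrDl (le_trans (ler_normD _ _))// lerD.
Qed.

Lemma lipschitz_constZ L a f :
  lipschitz_const L f -> lipschitz_const (`|a| * L) (a *: f).
Proof.
move=> [L0 fL]; split; first exact: mulr_ge0.
move=> x y; rewrite scalrfctE.
by rewrite -scalerBr normrZ -mulrA ler_wpM2l.
Qed.

Fact Lip0_submod_closed : subsemimod_closed Lip0_pred.
Proof.
split; first split.
- apply/asboolP; split => //; exists 0; split => // x y.
  by rewrite subrr normr0 mul0r.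
- move=> f g /asboolP[f0 [L fL]] /asboolP[g0 [K gK]]; apply/asboolP; split.
    by rewrite addrfctE f0 g0 addr0.
  by exists (L + K); exact: lipschitz_constD.
- move=> a f /asboolP[f0 [L fL]]; apply/asboolP; split.
    by rewrite scalrfctE f0 scaler0.
  by exists (`|a| * L); exact: lipschitz_constZ.
Qed.

HB.instance Definition _ := GRing.SubChoice_isSubLmodule.Build
  R (M -> R) Lip0_pred Lip0 Lip0_submod_closed.

Definition Lip0_norm (f : Lip0) : R := inf [set L | lipschitz_const L f].

Lemma Lip0_norm_le (f : Lip0) L : lipschitz_const L f -> Lip0_norm f <= L.
Proof. by move=> fL; apply: ge_inf => //; exists 0 => K []. Qed.

Lemma Lip0_norm_lipschitz (f : Lip0) : lipschitz_const (Lip0_norm f) f.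
Proof.
have [L fL] := Lip0_lipschitz f.
split; first by apply: lb_le_inf; [exists L|move=> K []].
move=> x y; have [d0|d0] := leP (mdist x y) 0.
  have d00 : mdist x y = 0 by apply/eqP; rewrite eq_le d0 mdist_ge0.
  by move: fL => [_ /(_ x y)]; rewrite d00 !mulr0.
rewrite -ler_pdivrMr//; apply: lb_le_inf; first by exists L.
by move=> K [_ fK]; rewrite ler_pdivrMr.
Qed.

Fact Lip0_normD (f g : Lip0) : Lip0_norm (f + g) <= Lip0_norm f + Lip0_norm g.
Proof.
by apply/Lip0_norm_le/lipschitz_constD; exact: Lip0_norm_lipschitz.
Qed.

Lemma Lip0_normZ_le a (f : Lip0) : Lip0_norm (a *: f) <= `|a| * Lip0_norm f.
Proof. by apply/Lip0_norm_le/lipschitz_constZ/Lip0_norm_lipschitz. Qed.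

Fact Lip0_normZ a (f : Lip0) : Lip0_norm (a *: f) = `|a| * Lip0_norm f.
Proof.
apply/eqP; rewrite eq_le Lip0_normZ_le/=.
have [->|a0] := eqVneq a 0.
  by rewrite normr0 mul0r; have [] := Lip0_norm_lipschitz (0 *: f).
rewrite -ler_pdivlMl ?normr_gt0// -normfV (le_trans _ (Lip0_normZ_le _ _))//.
by rewrite scalerA mulVf// scale1r.
Qed.

Fact Lip0_norm_eq0 (f : Lip0) : Lip0_norm f = 0 -> f = 0.
Proof.
move=> f0; apply/val_inj/funext => x.
have [_ /(_ x x0)] := Lip0_norm_lipschitz f.
by rewrite f0 mul0r Lip0_base subr0 normr_le0 => /eqP.
Qed.

HB.instance Definition _ := Lmodule_isNormed.Build R Lip0
  Lip0_normD Lip0_normZ Lip0_norm_eq0.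

End Lip0.

Section dual.
Context {R : realType} (V : normedModType R).

Definition dual_pred : {pred V -> R} :=
  fun f => `[< linear f /\ continuous f >].

Record dual := Dual {
  dual_val :> V -> R ;
  _ : dual_val \in dual_pred }.

HB.instance Definition _ := [isSub for dual_val].
HB.instance Definition _ := [Choice of dual by <:].

Fact dual_submod_closed : subsemimod_closed dual_pred.
Proof.
split; first split.
- apply/asboolP; split; last by move=> x; exact: cvg_cst.
  by move=> a x y; rewrite scaler0 addr0.
- move=> f g /asboolP[lf cf] /asboolP[lg cg]; apply/asboolP; split.
    move=> a x y; rewrite addrfctE lf lg.
    by rewrite scalerDr addrACA.
  by move=> x; apply: cvgD; [exact: cf|exact: cg].
- move=> a f /asboolP[lf cf]; apply/asboolP; split.
    move=> b x y; rewrite scalrfctE lf.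
    by rewrite scalerDr !scalerA mulrC.
  by move=> x; apply: cvgZr; exact: cf.
Qed.

HB.instance Definition _ := GRing.SubChoice_isSubLmodule.Build
  R (V -> R) dual_pred dual dual_submod_closed.

Lemma dual_linear (f : dual) : linear f.
Proof. by have /asboolP[] := valP f. Qed.

Lemma dual_continuous (f : dual) : continuous f.
Proof. by have /asboolP[] := valP f. Qed.

Local Notation unit_ball := [set x : V | `|x| <= 1].

Lemma dual_bounded (f : dual) : bounded_over unit_ball f.
Proof.
pose m := GRing.isLinear.Build R V R *:%R f (@dual_linear f).
pose F : {linear V -> R} := HB.pack (f : V -> R) m.
have : bounded_near F (nbhs (0 : V)).
  by apply/linear_bounded_continuous; exact: dual_continuous.
move=> /bounded_funP /(_ 1)[C fC].
by exists C => x; exact: fC.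
Qed.

Definition dual_norm (f : dual) : R := sup_norm unit_ball f.

Fact dual_normD f g : dual_norm (f + g) <= dual_norm f + dual_norm g.
Proof. by apply: sup_normD; exact: dual_bounded. Qed.

Fact dual_normZ a f : dual_norm (a *: f) = `|a| * dual_norm f.
Proof. by apply: sup_normZ; exact: dual_bounded. Qed.

Lemma dualZ (f : dual) a x : f (a *: x) = a *: f x.
Proof.
have f0 : f 0 = 0.
  have := dual_linear f 1 0 0; rewrite !scale1r addr0 => /eqP.
  by rewrite eq_sym -subr_eq0 addrK => /eqP.
by have := dual_linear f a x 0; rewrite f0 !addr0.
Qed.

Fact dual_norm_eq0 f : dual_norm f = 0 -> f = 0.
Proof.
move=> f0; apply/val_inj/funext => x; rewrite [RHS]/(0 : R).
have [->|xn0] := eqVneq x 0.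
  by have := dualZ f 0 0; rewrite !scale0r.
have := sup_norm_eq0 (x := `|x|^-1 *: x) (dual_bounded f) f0.
rewrite /= normrZ normfV normr_id mulVf ?normr_eq0//.
move=> /(_ (lexx _)); rewrite dualZ => /eqP.
by rewrite scaler_eq0 invr_eq0 normr_eq0 (negbTE xn0) => /eqP.
Qed.

HB.instance Definition _ := Lmodule_isNormed.Build R dual
  dual_normD dual_normZ dual_norm_eq0.

End dual.

Section closed_span.
Context {R : realType} {V : normedModType R}.
Implicit Type A : set V.

Definition linear_span A : set V :=
  [set v | exists n (c : 'I_n -> R) (a : 'I_n -> V),
    (forall i, A (a i)) /\ v = \sum_(i < n) c i *: a i].

Definition closed_span A : set V := closure (linear_span A).

Lemma linear_span0 A : linear_span A 0.
Proof.
exists 0, (fun=> 0), (fun=> 0); split; first by case.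
by rewrite big_ord0.
Qed.

Lemma linear_spanD A u v :
  linear_span A u -> linear_span A v -> linear_span A (u + v).
Proof.
move=> [n [c [a [aA ->]]]] [m [d [b [bA ->]]]].
pose pick T (f : 'I_n -> T) (g : 'I_m -> T) (i : 'I_(n + m)) :=
  match fintype.split i with inl j => f j | inr k => g k end.
exists (n + m)%N, (pick R c d), (pick V a b); split.
  by move=> i; rewrite /pick; case: fintype.split.
rewrite big_split_ord/=; congr (_ + _); apply: eq_bigr => i _.
  by rewrite /pick (unsplitK (inl i)).
by rewrite /pick (unsplitK (inr i)).
Qed.

Lemma linear_spanZ A a u : linear_span A u -> linear_span A (a *: u).
Proof.
move=> [n [c [b [bA ->]]]]; exists n, (fun i => a * c i), b; split => //.
by rewrite scaler_sumr; apply: eq_bigr => i _; rewrite scalerA.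
Qed.

Lemma closed_spanP A u : closed_span A u <->
  forall e : R, 0 < e -> exists2 v, linear_span A v & `|u - v| < e.
Proof.
split=> [Au e e0|Au B /nbhs_ballP[e /= e0 eB]].
  have [v [Av]] := Au _ (nbhsx_ballx u e e0).
  by rewrite -ball_normE => uv; exists v.
have [v Av uv] := Au e e0; exists v; split => //; apply: eB.
by rewrite -ball_normE.
Qed.

Lemma closed_span_submod_closed A :
  subsemimod_closed ((fun v => `[< closed_span A v >]) : {pred V}).
Proof.
split; first split.
- apply/asboolP/closed_spanP => e e0.
  by exists 0; [exact: linear_span0|rewrite subrr normr0].
- move=> u v /asboolP/closed_spanP uA /asboolP/closed_spanP vA.
  apply/asboolP/closed_spanP => e e0.
  have e20 : 0 < e / 2 by rewrite divr_gt0.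
  have [u' Au' uu'] := uA _ e20; have [v' Av' vv'] := vA _ e20.
  exists (u' + v'); first exact: linear_spanD.
  by rewrite opprD addrACA (le_lt_trans (ler_normD _ _))// [e]splitr ltrD.
- move=> a u /asboolP/closed_spanP uA; apply/asboolP/closed_spanP => e e0.
  have a1 : 0 < `|a| + 1 by rewrite ltr_wpDl.
  have [u' Au' uu'] := uA _ (divr_gt0 e0 a1).
  exists (a *: u'); first exact: linear_spanZ.
  rewrite -scalerBr normrZ (@le_lt_trans _ _ ((`|a| + 1) * `|u - u'|))//.
    by rewrite ler_wpM2r// lerDl.
  by rewrite mulrC -ltr_pdivlMr.
Qed.

End closed_span.

Section free_space.
Context {R : realType} (M : metricType R) (x0 : M).

Fact delta_subproof (x : M) :
  (fun f : Lip0 x0 => f x) \in @dual_pred R (Lip0 x0).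
Proof.
apply/asboolP; have lin : linear (fun f : Lip0 x0 => f x) by [].
split=> //.
pose m := GRing.isLinear.Build R (Lip0 x0) R *:%R _ lin.
pose F : {linear Lip0 x0 -> R} := HB.pack (fun f : Lip0 x0 => f x) m.
apply: (bounded_linear_continuous (f := F)).
apply/bounded_funP => r; exists (r * mdist x x0) => f fr.
have [_ /(_ x x0)] := Lip0_norm_lipschitz f.
by rewrite Lip0_base subr0 => /le_trans; apply; rewrite ler_wpM2r ?mdist_ge0.
Qed.

Definition delta (x : M) : dual (Lip0 x0) := Dual (delta_subproof x).

Definition free_space_pred : {pred dual (Lip0 x0)} :=
  fun mu => `[< closed_span (range delta) mu >].

Record free_space := FreeSpace {
  free_space_val :> dual (Lip0 x0) ;
  _ : free_space_val \in free_space_pred }.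

HB.instance Definition _ := [isSub for free_space_val].
HB.instance Definition _ := [Choice of free_space by <:].
HB.instance Definition _ := GRing.SubChoice_isSubLmodule.Build
  R (dual (Lip0 x0)) free_space_pred free_space
  (closed_span_submod_closed (range delta)).

Definition free_space_norm (mu : free_space) : R :=
  `|free_space_val mu|.

Fact free_space_normD mu nu :
  free_space_norm (mu + nu) <= free_space_norm mu + free_space_norm nu.
Proof. exact: ler_normD. Qed.

Fact free_space_normZ a mu :
  free_space_norm (a *: mu) = `|a| * free_space_norm mu.
Proof. exact: normrZ. Qed.

Fact free_space_norm_eq0 mu : free_space_norm mu = 0 -> mu = 0.
Proof. by move=> /normr0_eq0 mu0; exact/val_inj. Qed.

HB.instance Definition _ := Lmodule_isNormed.Build R free_space
  free_space_normD free_space_normZ free_space_norm_eq0.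

End free_space.

Definition linearly_isomorphic (R : realType) (V W : normedModType R) : Prop :=
  exists (f : {linear V -> W}) (g : {linear W -> V}),
    [/\ continuous f, continuous g, cancel f g & cancel g f].

(* Main.v *)
(* Write Z for the c0-sum and Y for l_infty.  A pair of Lipschitz maps
   i : N -> M, r : M -> N with r i = id complements F(N) in F(M), and
   Pelczynski's decomposition method applies because of three such pairs.
   - Y is a summand of Z.
   - Z embeds bi-Lipschitzly in Y by z |-> sup_{t in U} (+- z_t(k))^+, where U
     ranges over the countably many cylinders of 2^omega; it is then a Lipschitz
     retract of Y, by McShane extension of the coordinates of the inverse
     followed by soft thresholding at the distance to the image of Z.
   - The wedge of countably many copies of Y, realised as the union of the block
     subspaces of l_infty(N x N) = Y, is a Lipschitz retract of Y, by soft
     thresholding each block at the norm of the others; so the l_1-sum of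
     countably many copies of F(Y) is complemented in F(Y).
   Everything is done dually: a free space is represented by its dual, as a space
   of functions, and the bounded operators considered are those whose adjoint
   preserves finite combinations of evaluations. *)
From HB Require Import structures.
Require Import Defs.
From mathcomp Require Import all_boot all_order all_algebra.
From mathcomp Require Import all_classical all_reals all_analysis.
From mathcomp Require Import ring lra.

Set Implicit Arguments.
Unset Strict Implicit.
Unset Printing Implicit Defensive.

Import Order.TTheory GRing.Theory Num.Theory.
Import numFieldNormedType.Exports.

Local Open Scope classical_set_scope.
Local Open Scope ring_scope.

(** * The decomposition method for spaces of functions *)

Section evaluation_span.
Context {R : realType} {S : Type}.
Implicit Types (phi psi : (S -> R) -> R) (f g : S -> R).

(** The functionals act on all functions [S -> R], not only on Lipschitz ones, so that linearity and
    composition hold with no membership hypothesis. *)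
Inductive evaluation_span : ((S -> R) -> R) -> Prop :=
| evaluation_span0 : evaluation_span (fun=> 0)
| evaluation_span_eval x : evaluation_span (fun f => f x)
| evaluation_spanD phi psi : evaluation_span phi -> evaluation_span psi ->
    evaluation_span (fun f => phi f + psi f)
| evaluation_spanZ a phi : evaluation_span phi ->
    evaluation_span (fun f => a * phi f).

Lemma evaluation_spanN phi :
  evaluation_span phi -> evaluation_span (fun f => - phi f).
Proof.
move=> phiP; rewrite (_ : (fun f => _) = fun f => -1 * phi f).
  exact: evaluation_spanZ.
by apply/funext => f; rewrite mulN1r.
Qed.

Lemma evaluation_span_linear phi : evaluation_span phi ->
  forall a f g, phi (a *: f + g) = a * phi f + phi g.
Proof.
elim=> [|x|{}phi psi _ phiP _ psiP|b {}phi _ phiP] a f g //.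
- by rewrite mulr0 addr0.
- by rewrite phiP psiP mulrDr addrACA.
- by rewrite phiP mulrDr !mulrA [b * a]mulrC.
Qed.

End evaluation_span.

Lemma evaluation_span_comp {R : realType} (S S' : Type)
    (T : (S -> R) -> S' -> R) (phi : (S' -> R) -> R) :
  (forall x, evaluation_span (T^~ x)) -> evaluation_span phi ->
  evaluation_span (phi \o T).
Proof.
move=> TP; elim=> [|x|{}phi psi _ phiP _ psiP|b {}phi _ phiP].
- exact: evaluation_span0.
- exact: TP.
- exact: (evaluation_spanD phiP psiP).
- exact: (evaluation_spanZ b phiP).
Qed.

(** A relation bounding the norm, in place of a norm, lets finite and countable sums be defined by
    conjunction and quantification, with no suprema. *)
Definition fspace_axiom (R : realType) (S : Type)
    (bound : R -> (S -> R) -> Prop) :=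
  [/\ forall K f, bound K f -> 0 <= K,
      forall K L f, K <= L -> bound K f -> bound L f,
      forall K L f g, bound K f -> bound L g -> bound (K + L) (f + g) &
      forall K f, bound K f -> bound K (- f)].

(* [fbound A K f] stands for: f belongs to the function space A and has norm at
   most K. *)
Record fspace (R : realType) := FSpace {
  fpoint : Type ;
  fbound : R -> (fpoint -> R) -> Prop ;
  fspaceP : fspace_axiom fbound }.

Arguments fbound {R} A K f : rename.

Section fspace_theory.
Context {R : realType} (A : fspace R).

Lemma fbound_ge0 K f : fbound A K f -> 0 <= K.
Proof. by case: (fspaceP A) => + _ _ _; exact. Qed.

Lemma fbound_le K L f : K <= L -> fbound A K f -> fbound A L f.
Proof. by case: (fspaceP A) => _ + _ _; exact. Qed.

Lemma fboundD K L f g :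
  fbound A K f -> fbound A L g -> fbound A (K + L) (f + g).
Proof. by case: (fspaceP A) => _ _ + _; exact. Qed.

Lemma fboundN K f : fbound A K f -> fbound A K (- f).
Proof. by case: (fspaceP A) => _ _ _; exact. Qed.

Lemma fboundB K L f g :
  fbound A K f -> fbound A L g -> fbound A (K + L) (f - g).
Proof. by move=> fK /fboundN; exact: fboundD. Qed.

End fspace_theory.

Section operators.
Context {R : realType}.
Implicit Types A B C D : fspace R.

(* Pointwise membership in [evaluation_span] makes the adjoint of [T] map
   evaluation functionals to their finite linear combinations. *)
Definition operator A B (T : (fpoint A -> R) -> fpoint B -> R) :=
  (forall x, evaluation_span (T^~ x)) /\
  exists2 L, 0 <= L & forall K f, fbound A K f -> fbound B (L * K) (T f).

(** Operators are defined on all functions, but only their values on functions with a bound matter;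
    hence the restricted inverse identities. *)
Definition fiso A B := exists T S, [/\ @operator A B T, @operator B A S,
  forall K f, fbound A K f -> S (T f) = f &
  forall K g, fbound B K g -> T (S g) = g].

Definition complemented A B := exists T S, [/\ @operator A B T,
  @operator B A S & forall K f, fbound A K f -> S (T f) = f].

Lemma operator_id A : @operator A A id.
Proof.
split; first exact: evaluation_span_eval.
by exists 1 => // K f; rewrite mul1r.
Qed.

Lemma operator_comp A B C T S : @operator A B T -> @operator B C S ->
  @operator A C (S \o T).
Proof.
move=> [Tl [K K0 TK]] [Sl [L L0 SL]]; split.
  by move=> x; exact: (evaluation_span_comp Tl (Sl x)).
exists (L * K) => [|M f fM]; first exact: mulr_ge0.
by rewrite -mulrA; apply/SL/TK.
Qed.

Lemma operator_reindex A B (h : fpoint B -> fpoint A) L : 0 <= L ->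
  (forall K f, fbound A K f -> fbound B (L * K) (f \o h)) ->
  @operator A B (fun f => f \o h).
Proof.
move=> L0 hP; split; first by move=> x; exact: evaluation_span_eval.
by exists L.
Qed.

Lemma fiso_reindex A B (h : fpoint B -> fpoint A) (k : fpoint A -> fpoint B) :
  cancel h k -> cancel k h ->
  (forall K f, fbound A K f -> fbound B K (f \o h)) ->
  (forall K f, fbound B K f -> fbound A K (f \o k)) ->
  fiso A B.
Proof.
move=> hk kh hP kP; exists (fun f => f \o h), (fun f => f \o k).
split.
- by apply: (operator_reindex (L := 1)) => // K f; rewrite mul1r; exact: hP.
- by apply: (operator_reindex (L := 1)) => // K f; rewrite mul1r; exact: kP.
- by move=> K f _; apply/funext => x /=; rewrite kh.
- by move=> K f _; apply/funext => x /=; rewrite hk.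
Qed.

Lemma fiso_sym A B : fiso A B -> fiso B A.
Proof. by move=> [T [S [? ? ? ?]]]; exists S, T. Qed.

Lemma fiso_refl A : fiso A A.
Proof. by exists id, id; split => //; exact: operator_id. Qed.

Lemma fiso_trans B A C : fiso A B -> fiso B C -> fiso A C.
Proof.
move=> [T [S [oT oS TK SK]]] [T' [S' [oT' oS' TK' SK']]].
exists (T' \o T), (S \o S'); split; try exact: operator_comp.
- move=> K f fK /=; have [_ [L _ TL]] := oT.
  by rewrite (TK' _ _ (TL _ _ fK)) (TK _ _ fK).
- move=> K f fK /=; have [_ [L _ SL]] := oS'.
  by rewrite (SK _ _ (SL _ _ fK)) (SK' _ _ fK).
Qed.

Lemma complemented_refl A : complemented A A.
Proof. by exists id, id; split => //; exact: operator_id. Qed.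

Fact fsum_subproof A B : fspace_axiom
  (fun K (f : fpoint A + fpoint B -> R) =>
    fbound A K (f \o inl) /\ fbound B K (f \o inr)).
Proof.
split.
- by move=> K f [/fbound_ge0].
- by move=> K L f KL [fA fB]; split; exact: fbound_le KL _.
- by move=> K L f g [fA fB] [gA gB]; split; exact: fboundD.
- by move=> K f [fA fB]; split; exact: fboundN.
Qed.

Definition fsum A B := FSpace (fsum_subproof A B).

Fact fcountable_sum_subproof A : fspace_axiom
  (fun K (f : nat * fpoint A -> R) => forall n, fbound A K (fun x => f (n, x))).
Proof.
split.
- by move=> K f /(_ 0)/fbound_ge0.
- by move=> K L f KL fK n; exact: fbound_le KL _.
- by move=> K L f g fK gL n; exact: (fboundD (fK n) (gL n)).
- by move=> K f fK n; exact: (fboundN (fK n)).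
Qed.

(** For A a space of Lipschitz functions, this is the dual of the l_1-sum of countably many copies
    of the free space. *)
Definition fcountable_sum A := FSpace (fcountable_sum_subproof A).

Lemma fsumC A B : fiso (fsum A B) (fsum B A).
Proof.
pose swap X Y (x : X + Y) := match x with inl a => inr a | inr b => inl b end.
apply: (@fiso_reindex (fsum A B) (fsum B A) (@swap _ _) (@swap _ _)).
- by case.
- by case.
- by move=> K f [].
- by move=> K f [].
Qed.

Lemma fsumA A B C : fiso (fsum (fsum A B) C) (fsum A (fsum B C)).
Proof.
pose h (x : fpoint A + (fpoint B + fpoint C)) :=
  match x with
  | inl a => inl (inl a) | inr (inl b) => inl (inr b) | inr (inr c) => inr c
  end.
pose k (x : (fpoint A + fpoint B) + fpoint C) :=
  match x with
  | inl (inl a) => inl a | inl (inr b) => inr (inl b) | inr c => inr (inr c)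
  end.
apply: (@fiso_reindex (fsum (fsum A B) C) (fsum A (fsum B C)) h k).
- by move=> [|[]].
- by move=> [[]|].
- by move=> K f [[]].
- by move=> K f [? []].
Qed.

(** Hilbert's hotel: only the A-copies are renumbered by one, which frees a place for the extra A;
    the B-copies stay put. *)
Lemma fcountable_sum_absorb A B :
  fiso (fcountable_sum (fsum A B)) (fsum A (fcountable_sum (fsum A B))).
Proof.
pose h (x : fpoint A + nat * (fpoint A + fpoint B)) :=
  match x with
  | inl a => (0%N, inl a)
  | inr (n, inl a) => (n.+1, inl a)
  | inr (n, inr b) => (n, inr b)
  end.
pose k (x : nat * (fpoint A + fpoint B)) :=
  match x with
  | (n, inr b) => inr (n, inr b)
  | (0%N, inl a) => inl a
  | (n.+1, inl a) => inr (n, inl a)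
  end.
apply: (@fiso_reindex (fcountable_sum (fsum A B))
  (fsum A (fcountable_sum (fsum A B))) h k).
- by move=> [|[[|n] []]].
- by move=> [[|n] []].
- move=> K f fK; split; first by case: (fK 0%N).
  by move=> n; split; [case: (fK n.+1)|case: (fK n)].
- move=> K f [fA fS] [|n]; split => //; [by case: (fS 0%N)| |].
    by case: (fS n).
  by case: (fS n.+1).
Qed.

Lemma fsum_operator A A' B B' T T' : @operator A A' T -> @operator B B' T' ->
  @operator (fsum A B) (fsum A' B') (fun f x =>
    match x with inl a => T (f \o inl) a | inr b => T' (f \o inr) b end).
Proof.
move=> [Tl [L L0 TL]] [Tl' [L' L'0 TL']]; split.
  have inlP x : evaluation_span (fun f : fpoint A + fpoint B -> R => f (inl x)).
    exact: evaluation_span_eval.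
  have inrP x : evaluation_span (fun f : fpoint A + fpoint B -> R => f (inr x)).
    exact: evaluation_span_eval.
  move=> [a|b].
    exact: (evaluation_span_comp (T := fun f => f \o inl) inlP (Tl a)).
  exact: (evaluation_span_comp (T := fun f => f \o inr) inrP (Tl' b)).
exists (L + L') => [|K f [fA fB]]; first exact: addr_ge0.
have K0 := fbound_ge0 fA.
split; [apply: fbound_le (TL _ _ fA)|apply: fbound_le (TL' _ _ fB)];
  by rewrite ler_wpM2r// (lerDl, lerDr).
Qed.

Lemma fsum_fiso A A' B B' :
  fiso A A' -> fiso B B' -> fiso (fsum A B) (fsum A' B').
Proof.
move=> [T [S [oT oS TK SK]]] [T' [S' [oT' oS' TK' SK']]].
exists (fun f x =>
  match x with inl a => T (f \o inl) a | inr b => T' (f \o inr) b end).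
exists (fun f x =>
  match x with inl a => S (f \o inl) a | inr b => S' (f \o inr) b end).
split; [exact: fsum_operator|exact: fsum_operator| |].
- move=> K f [fA fB]; apply/funext => -[a|b].
    exact: (congr1 (@^~ a) (TK _ _ fA)).
  exact: (congr1 (@^~ b) (TK' _ _ fB)).
- move=> K f [fA fB]; apply/funext => -[a|b].
    exact: (congr1 (@^~ a) (SK _ _ fA)).
  exact: (congr1 (@^~ b) (SK' _ _ fB)).
Qed.

Lemma fcountable_sum_operator A B T : @operator A B T ->
  @operator (fcountable_sum A) (fcountable_sum B)
    (fun f x => T (fun y => f (x.1, y)) x.2).
Proof.
move=> [Tl [L L0 TL]]; split; last first.
  by exists L => // K f fK n; exact: (TL _ _ (fK n)).
move=> [n b] /=.
have pairP x : evaluation_span (fun f : nat * fpoint A -> R => f (n, x)).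
  exact: evaluation_span_eval.
exact: (evaluation_span_comp (T := fun f x => f (n, x)) pairP (Tl b)).
Qed.

Lemma fcountable_sum_fiso A B :
  fiso A B -> fiso (fcountable_sum A) (fcountable_sum B).
Proof.
move=> [T [S [oT oS TK SK]]].
exists (fun f x => T (fun y => f (x.1, y)) x.2).
exists (fun f x => S (fun y => f (x.1, y)) x.2).
split; try exact: fcountable_sum_operator.
- move=> K f fK; apply/funext => -[n x].
  exact: (congr1 (@^~ x) (TK _ _ (fK n))).
- move=> K f fK; apply/funext => -[n x].
  exact: (congr1 (@^~ x) (SK _ _ (fK n))).
Qed.

(* The complement consists of the functions killed by the left inverse; dually,
   it is the quotient of the free space of M by that of A. *)
Lemma complemented_fsum A M :
  complemented A M -> exists Q, fiso M (fsum A Q).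
Proof.
move=> [T [S [oT oS TK]]].
have [[Tl [L L0 TL]] [Sl [L' L'0 SL]]] := (oT, oS).
have SD f g : S (f + g) = S f + S g.
  apply/funext => x.
  by rewrite -[f]scale1r (evaluation_span_linear (Sl x)) mul1r scale1r.
have SN f : S (- f) = - S f.
  apply/funext => x; have := evaluation_span_linear (Sl x) (-1) f 0.
  have -> : S 0 x = 0.
    have := evaluation_span_linear (Sl x) (-1) 0 0.
    by rewrite scaler0 addr0 mulN1r addNr.
  by rewrite scaleN1r !addr0 mulN1r.
have kerP : fspace_axiom (fun K f => fbound M K f /\ S f = 0).
  split.
  - by move=> K f [/fbound_ge0].
  - by move=> K K' f KK' [fK f0]; split => //; exact: fbound_le fK.
  - move=> K K' f g [fK f0] [gK g0]; split; first exact: fboundD.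
    by rewrite SD f0 g0 addr0.
  - by move=> K f [fK f0]; split; [exact: fboundN|rewrite SN f0 oppr0].
(* [T \o S] is a projection, so g splits as T (S g) plus a function killed by S. *)
exists (FSpace kerP), (fun g x =>
  match x with inl a => S g a | inr x => g x - T (S g) x end).
exists (fun f x => T (f \o inl) x + f (inr x)).
split.
- split.
    move=> [a|x]; first exact: Sl.
    apply: evaluation_spanD; first exact: evaluation_span_eval.
    apply: evaluation_spanN.
    exact: (evaluation_span_comp Sl (Tl x)).
  exists (L' + (1 + L * L')); first by rewrite !addr_ge0// mulr_ge0.
  move=> K f fK; have K0 := fbound_ge0 fK; split.
    apply: fbound_le (SL _ _ fK).
    by rewrite ler_wpM2r// lerDl addr_ge0// mulr_ge0.
  split.
    apply: (@fbound_le _ _ (K + L * (L' * K))).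
      by rewrite mulrDl mulrDl mul1r mulrA lerDr mulr_ge0.
    by apply: fboundB => //; exact/TL/SL.
  rewrite (_ : _ \o inr = f - T (S f))//.
  by rewrite SD SN (TK _ _ (SL _ _ fK)) subrr.
- split.
    move=> x; apply: evaluation_spanD; last exact: evaluation_span_eval.
    have inlP y :
        evaluation_span (fun f : fpoint A + fpoint M -> R => f (inl y)).
      exact: evaluation_span_eval.
    exact: (evaluation_span_comp (T := fun f => f \o inl) inlP (Tl x)).
  exists (L + 1) => [|K f [fA [fM _]]]; first exact: addr_ge0.
  by rewrite mulrDl mul1r; exact: (fboundD (TL _ _ fA) fM).
- move=> K f fK; apply/funext => x /=.
  by rewrite (_ : _ \o inl = S f)// addrCA subrr addr0.
- move=> K f [fA [fM fS]]; apply/funext => x.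
  have E : S (fun x => T (f \o inl) x + f (inr x)) = f \o inl.
    rewrite (_ : (fun x => _) = T (f \o inl) + (f \o inr))//.
    by rewrite SD (TK _ _ fA) fS addr0.
  case: x => [a|x] /=; rewrite E//.
  by rewrite addrAC subrr add0r.
Qed.

(** With W the countable sum of copies of Y, Y = W + Q and Y = A + Q'. The countable sum of copies
    of A + Q' absorbs one more A, so W = A + W and Y = A + W + Q = A + Y. *)
Lemma complemented_absorb A Y : complemented (fcountable_sum Y) Y ->
  complemented A Y -> fiso Y (fsum A Y).
Proof.
move=> /complemented_fsum[Q YQ] /complemented_fsum[Q' YQ'].
set W := fcountable_sum Y in YQ.
have WW : fiso W (fsum A W).
  apply: fiso_trans (fcountable_sum_fiso YQ') _.
  apply: fiso_trans (fcountable_sum_absorb _ _) _.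
  apply: fsum_fiso; first exact: fiso_refl.
  exact: fiso_sym (fcountable_sum_fiso YQ').
apply: (fiso_trans YQ); apply: fiso_trans (fsum_fiso WW (fiso_refl Q)) _.
apply: fiso_trans (fsumA _ _ _) _.
by apply: fsum_fiso; [exact: fiso_refl|exact: fiso_sym YQ].
Qed.

(** The chain is Z = Y + Q = (Y + Y) + Q = Y + (Y + Q) = Y + Z = Y; its second and last links are
    instances of [complemented_absorb]. *)
Lemma pelczynski_decomposition Y Z : complemented (fcountable_sum Y) Y ->
  complemented Z Y -> complemented Y Z -> fiso Z Y.
Proof.
move=> WY ZY /complemented_fsum[Q ZQ].
have YY := complemented_absorb WY (complemented_refl Y).
have YZ := complemented_absorb WY ZY.
apply: (fiso_trans ZQ); apply: fiso_trans (fsum_fiso YY (fiso_refl Q)) _.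
apply: fiso_trans (fsumA _ _ _) _; apply: fiso_trans (fsumC _ _) _.
apply: fiso_trans (fsum_fiso (fiso_sym ZQ) (fiso_refl Y)) _.
exact: fiso_sym YZ.
Qed.

End operators.

(** * From spaces of Lipschitz functions to free spaces *)

Section dual_bounds.
Context {R : realType} {V : normedModType R}.

Lemma dual_bound (f : dual V) v : `|f v| <= `|f| * `|v|.
Proof.
have [->|v0] := eqVneq v 0.
  by have := dualZ f 0 0; rewrite !scale0r => ->; rewrite !normr0 mulr0.
have nv : 0 < `|v| by rewrite normr_gt0.
have := sup_norm_ub (x := `|v|^-1 *: v) (dual_bounded f).
rewrite /= normrZ normfV normr_id mulVf ?gt_eqF// => /(_ (lexx _)).
by rewrite dualZ normrZ normfV normr_id mulrC ler_pdivrMr.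
Qed.

Lemma bounded_linear_dual (f : V -> R) C :
  linear f -> (forall v, `|f v| <= C * `|v|) -> f \in @dual_pred R V.
Proof.
move=> lin fC; apply/asboolP; split=> //.
pose m := GRing.isLinear.Build R V R _ f lin.
pose F : {linear V -> R} := HB.pack f m.
apply: (bounded_linear_continuous (f := F)); apply/bounded_funP => r.
exists (`|C| * r) => v vr; rewrite (le_trans (fC v))//.
rewrite (@le_trans _ _ (`|C| * `|v|))//; first by rewrite ler_wpM2r// ler_norm.
by rewrite ler_wpM2l.
Qed.

Lemma dual_norm_bound (f : dual V) C :
  0 <= C -> (forall v, `|f v| <= C * `|v|) -> `|f| <= C.
Proof.
move=> C0 fC; apply: sup_norm_le => // v /= v1.
by rewrite (le_trans (fC v))// ler_piMr.
Qed.

End dual_bounds.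

Fact lip_fspace_subproof (R : realType) (M : metricType R) (x0 : M) :
  fspace_axiom (fun K (f : M -> R) => f x0 = 0 /\ lipschitz_const K f).
Proof.
split.
- by move=> K f [_ []].
- move=> K L f KL [f0 [K0 fK]]; split=> //; split; first exact: le_trans KL.
  by move=> x y; rewrite (le_trans (fK x y))// ler_wpM2r// mdist_ge0.
- move=> K L f g [f0 fK] [g0 gL]; split; last exact: lipschitz_constD.
  by rewrite addrfctE f0 g0 addr0.
- move=> K f [f0 [K0 fK]]; split; first by rewrite opprfctE f0 oppr0.
  by split=> // x y; rewrite opprfctE -opprD normrN.
Qed.

Definition lip_fspace (R : realType) (M : metricType R) (x0 : M) :=
  FSpace (lip_fspace_subproof x0).

Section predual.
Context {R : realType} {M N : metricType R} (x0 : M) (y0 : N).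
Variables (T : (N -> R) -> M -> R)
  (oT : @operator R (lip_fspace y0) (lip_fspace x0) T).

Fact lift_subproof (h : Lip0 y0) : T h \in @Lip0_pred R M x0.
Proof.
have [_ [L _ TL]] := oT.
have [|Th0 ThL] := TL (Lip0_norm h) h.
  by split; [exact: Lip0_base|exact: Lip0_norm_lipschitz].
by apply/asboolP; split => //; exists (L * Lip0_norm h).
Qed.

Definition lift (h : Lip0 y0) : Lip0 x0 := MkLip0 (lift_subproof h).

Lemma lift_linear a h k : lift (a *: h + k) = a *: lift h + lift k.
Proof.
apply/val_inj/funext => x; have [Tl _] := oT.
exact: (evaluation_span_linear (Tl x)).
Qed.

Lemma lift_bounded : exists2 L, 0 <= L & forall h, `|lift h| <= L * `|h|.
Proof.
have [_ [L L0 TL]] := oT; exists L => // h.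
have [|_ ThL] := TL (Lip0_norm h) h.
  by split; [exact: Lip0_base|exact: Lip0_norm_lipschitz].
exact: Lip0_norm_le.
Qed.

Fact adjoint_subproof (mu : dual (Lip0 x0)) :
  (fun h => mu (lift h)) \in @dual_pred R (Lip0 y0).
Proof.
have [L L0 liftL] := lift_bounded.
apply: (bounded_linear_dual (C := `|mu| * L)).
  by move=> a h k; rewrite lift_linear; exact: dual_linear.
move=> h; rewrite (le_trans (dual_bound _ _))// -mulrA.
by rewrite ler_wpM2l.
Qed.

Definition adjoint (mu : dual (Lip0 x0)) : dual (Lip0 y0) :=
  Dual (adjoint_subproof mu).

Lemma adjoint_bounded :
  exists2 L, 0 <= L & forall mu, `|adjoint mu| <= L * `|mu|.
Proof.
have [L L0 liftL] := lift_bounded; exists L => // mu.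
apply: dual_norm_bound; first exact: mulr_ge0.
move=> h; rewrite (le_trans (dual_bound mu (lift h)))// [L * _]mulrC -mulrA.
by rewrite ler_wpM2l// liftL.
Qed.

Lemma adjointD mu nu : adjoint (mu + nu) = adjoint mu + adjoint nu.
Proof. exact/val_inj. Qed.

Lemma adjointZ a mu : adjoint (a *: mu) = a *: adjoint mu.
Proof. exact/val_inj. Qed.

Lemma adjoint_delta x : linear_span (range (delta y0)) (adjoint (delta x0 x)).
Proof.
(* The functional phi lives on all functions on N, so an element of the dual agreeing with it on
   [Lip0 y0] is built along the same induction. *)
suff H phi : evaluation_span phi ->
    exists2 v : dual (Lip0 y0), linear_span (range (delta y0)) v &
      forall h : Lip0 y0, v h = phi h.
  have [Tl _] := oT; have [v vP vE] := H _ (Tl x).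
  by rewrite (_ : adjoint _ = v)//; apply/val_inj/funext => h; exact: esym (vE h).
elim=> [|y|{}phi psi _ [v vP vE] _ [w wP wE]|a {}phi _ [v vP vE]].
- by exists 0 => //; exact: linear_span0.
- exists (delta y0 y) => //.
  exists 1%N, (fun=> 1), (fun=> delta y0 y).
  by split; [move=> _; exists y|rewrite big_ord1 scale1r].
- exists (v + w); first exact: linear_spanD.
  by move=> h; rewrite -vE -wE.
- exists (a *: v); first exact: linear_spanZ.
  by move=> h; rewrite -vE.
Qed.

Lemma adjoint_linear_span mu : linear_span (range (delta x0)) mu ->
  linear_span (range (delta y0)) (adjoint mu).
Proof.
move=> [n [c [a [aP ->]]]].
have a0 : adjoint 0 = 0 by have := adjointZ 0 0; rewrite !scale0r.
rewrite (big_morph _ adjointD a0); apply: big_ind.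
- exact: linear_span0.
- exact: linear_spanD.
- move=> i _; rewrite adjointZ; apply: linear_spanZ.
  by have [x _ <-] := aP i; exact: adjoint_delta.
Qed.

Fact free_map_subproof (mu : free_space x0) :
  adjoint mu \in @free_space_pred R N y0.
Proof.
apply/asboolP/closed_spanP => e e0.
have [L L0 aL] := adjoint_bounded.
(* L may be 0, so e is divided by L + 1. *)
have L1 : 0 < L + 1 by rewrite ltr_wpDl.
have /asboolP/closed_spanP/(_ _ (divr_gt0 e0 L1))[nu nuP munu] := valP mu.
exists (adjoint nu); first exact: adjoint_linear_span.
rewrite -[- _]scaleN1r -adjointZ -adjointD scaleN1r.
rewrite (le_lt_trans (aL _))// (@le_lt_trans _ _ ((L + 1) * `|val mu - nu|))//.
  by rewrite ler_wpM2r// lerDl.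
by rewrite mulrC -ltr_pdivlMr.
Qed.

Definition free_map (mu : free_space x0) : free_space y0 :=
  FreeSpace (free_map_subproof mu).

Fact free_map_linear : linear free_map.
Proof. by move=> a mu nu; apply/val_inj/val_inj. Qed.

HB.instance Definition _ := GRing.isLinear.Build R
  (free_space x0) (free_space y0) _ free_map free_map_linear.

Lemma free_map_continuous : continuous free_map.
Proof.
apply: bounded_linear_continuous; apply/bounded_funP => r.
have [L L0 aL] := adjoint_bounded; exists (L * r) => mu mur.
by rewrite (le_trans (aL _))// ler_wpM2l.
Qed.

End predual.

Lemma fiso_free_space (R : realType) (M N : metricType R) (x0 : M) (y0 : N) :
  fiso (lip_fspace x0) (lip_fspace y0) ->
  linearly_isomorphic (free_space x0) (free_space y0).
Proof.
move=> [T [S [oT oS TK SK]]].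
(* Adjoints reverse arrows: S induces the map from the free space of M to that of N. *)
exists (free_map oS), (free_map oT).
split; try exact: free_map_continuous.
- move=> mu; apply/val_inj/val_inj/funext => h /=.
  congr (val (val mu) _); apply/val_inj => /=.
  apply: (TK (Lip0_norm h)); split; first exact: Lip0_base.
  exact: Lip0_norm_lipschitz.
- move=> mu; apply/val_inj/val_inj/funext => h /=.
  congr (val (val mu) _); apply/val_inj => /=.
  apply: (SK (Lip0_norm h)); split; first exact: Lip0_base.
  exact: Lip0_norm_lipschitz.
Qed.

(** * Lipschitz retractions *)

Lemma sup_norm_dist (R : realType) (T : Type) (V : normedModType R)
    (S : set T) (f g : T -> V) e :
  bounded_over S f -> bounded_over S g -> 0 <= e ->
  (forall x, S x -> `|f x - g x| <= e) -> `|sup_norm S f - sup_norm S g| <= e.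
Proof.
move=> bf bg e0 fg; rewrite ler_distlC lerBlDr; apply/andP; split.
  apply: sup_norm_le => [|x Sx]; first by rewrite addr_ge0 ?sup_norm_ge0.
  rewrite -[f x](subrK (g x)) [_ + e]addrC (le_trans (ler_normD _ _))// lerD//.
    exact: fg.
  exact: sup_norm_ub.
apply: sup_norm_le => [|x Sx]; first by rewrite addr_ge0 ?sup_norm_ge0.
rewrite -[g x](subrK (f x)) [_ + e]addrC (le_trans (ler_normD _ _))// lerD//.
  by rewrite distrC fg.
exact: sup_norm_ub.
Qed.

(** * Soft thresholding on the real line *)

Section soft_threshold.
Context {R : realType}.
Implicit Types a b c s : R.

(** For s >= 0 this moves a towards 0 by s and stops at 0. The form with max and min reduces its
    estimates to linear arithmetic. *)
Definition soft s a := Num.max (a - s) 0 + Num.min (a + s) 0.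

(** The estimate is joint in value and threshold because the retractions below use a threshold that
    varies with the point. *)
Lemma soft_dist s s' a b : 0 <= s -> 0 <= s' ->
  `|soft s a - soft s' b| <= `|a - b| + `|s - s'|.
Proof.
move=> s0 s'0.
have ab : a - b <= `|a - b| by exact: ler_norm.
have ba : b - a <= `|a - b| by rewrite distrC ler_norm.
have ss' : s - s' <= `|s - s'| by exact: ler_norm.
have s's : s' - s <= `|s - s'| by rewrite distrC ler_norm.
rewrite ler_norml /soft; apply/andP.
case: (leP (a - s) 0) => ?; case: (leP (b - s') 0) => ?;
case: (leP (a + s) 0) => ?; case: (leP (b + s') 0) => ?; split; lra.
Qed.

Lemma soft0 a : soft 0 a = a.
Proof. by rewrite /soft subr0 addr0 addr_max_min addr0. Qed.

Lemma soft_le s a c : 0 <= s -> 0 <= c -> `|a| <= s + c -> `|soft s a| <= c.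
Proof.
rewrite !ler_norml /soft => s0 c0 /andP[? ?]; apply/andP.
by case: (leP (a - s) 0) => ?; case: (leP (a + s) 0) => ?; split; lra.
Qed.

Lemma soft_norm_le s a : 0 <= s -> `|soft s a| <= `|a|.
Proof. by move=> s0; rewrite soft_le// lerDr. Qed.

Lemma soft_eq0 s a : `|a| <= s -> soft s a = 0.
Proof.
move=> as_; apply/eqP; rewrite -normr_le0 soft_le ?addr0//.
exact: le_trans (normr_ge0 a) as_.
Qed.

End soft_threshold.

Section ell_infty_theory.
Context {R : realType}.
Implicit Types x y : ell_infty R.

Lemma ell_infty_coord x n : `|x n| <= `|x|.
Proof. exact: (sup_norm_ub (ell_inftyP x)). Qed.

Lemma ell_infty_coordB x y n : `|x n - y n| <= `|x - y|.
Proof. exact: (ell_infty_coord (x - y)). Qed.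

Lemma ell_infty_norm_le x C :
  0 <= C -> (forall n, `|x n| <= C) -> `|x| <= C.
Proof. by move=> C0 xC; exact: sup_norm_le. Qed.

Lemma ell_infty_dist_le x y C :
  0 <= C -> (forall n, `|x n - y n| <= C) -> `|x - y| <= C.
Proof. by move=> C0 xyC; apply: sup_norm_le => // n _; exact: xyC. Qed.

End ell_infty_theory.

Section c0_sum_theory.
Context {R : realType} {I : Type} {V : normedModType R}.
Implicit Types x y : c0_sum I V.

Lemma c0_sum_coord x t : `|x t| <= `|x|.
Proof. exact: (sup_norm_ub (c0_sum_bounded x)). Qed.

Lemma c0_sum_coordB x y t : `|x t - y t| <= `|x - y|.
Proof. exact: (c0_sum_coord (x - y)). Qed.

Lemma c0_sum_dist_le x y C :
  0 <= C -> (forall t, `|x t - y t| <= C) -> `|x - y| <= C.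
Proof. by move=> C0 xyC; apply: sup_norm_le => // t _; exact: xyC. Qed.

End c0_sum_theory.

(** * McShane extension of real Lipschitz functions *)

Section mcshane.
Context {R : realType} {M : metricType R} {Z : Type} (z0 : Z) (i : Z -> M).
Context (a : Z -> R) (C : R) (C0 : 0 <= C).
Hypothesis aC : forall z z', a z - a z' <= C * mdist (i z) (i z').

(** McShane's formula is written along a map i instead of for a subset of M, so that the inverse of
    i on its image is never named. For a = 0 it gives C times the distance to the image of i. *)
Definition mcshane y := inf [set a z + C * mdist y (i z) | z in [set: Z]].

Let mcshane_has_inf y :
  has_inf [set a z + C * mdist y (i z) | z in [set: Z]].
Proof.
split; first by exists (a z0 + C * mdist y (i z0)), z0.
exists (a z0 - C * mdist y (i z0)) => _ [z _ <-].
rewrite lerBlDr -addrA -lerBlDl (le_trans (aC _ _))// -mulrDr ler_wpM2l//.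
by rewrite addrC [mdist y (i z0)]metric_sym metric_triangle.
Qed.

Lemma mcshane_le y z : mcshane y <= a z + C * mdist y (i z).
Proof. by apply: ge_inf; [case: (mcshane_has_inf y)|exists z]. Qed.

Lemma mcshane_adherent y e :
  0 < e -> exists z, a z + C * mdist y (i z) < mcshane y + e.
Proof.
by move=> e0; have [_ [z _ <-]] := inf_adherent e0 (mcshane_has_inf y); exists z.
Qed.

Lemma mcshane_extends z : mcshane (i z) = a z.
Proof.
apply/eqP; rewrite eq_le; apply/andP; split.
  by rewrite (le_trans (mcshane_le _ z))// mdistxx mulr0 addr0.
apply: lb_le_inf; first by exists (a z + C * mdist (i z) (i z)), z.
by move=> _ [z' _ <-]; rewrite -lerBlDl.
Qed.

Let mcshane_leD y y' : mcshane y <= mcshane y' + C * mdist y y'.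
Proof.
rewrite -lerBlDr; apply: lb_le_inf.
  by exists (a z0 + C * mdist y' (i z0)), z0.
move=> _ [z _ <-]; rewrite lerBlDr (le_trans (mcshane_le y z))//.
by rewrite -addrA lerD2l -mulrDr ler_wpM2l// addrC metric_triangle.
Qed.

Lemma mcshane_lipschitz y y' : `|mcshane y - mcshane y'| <= C * mdist y y'.
Proof.
by rewrite ler_norml lerBlDl mcshane_leD lerNl opprB lerBlDl metric_sym
  mcshane_leD.
Qed.

End mcshane.

Definition lipschitz_map {R : realType} {M N : metricType R} (h : M -> N) :=
  exists2 L, 0 <= L & forall x y, mdist (h x) (h y) <= L * mdist x y.

Lemma lipschitz_map_operator (R : realType) (M N : metricType R)
    (x0 : M) (y0 : N) (h : M -> N) : lipschitz_map h -> h x0 = y0 ->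
  @operator R (lip_fspace y0) (lip_fspace x0) (fun f => f \o h).
Proof.
move=> [L L0 hL] h0.
apply: (@operator_reindex _ (lip_fspace y0) (lip_fspace x0) _ L) => //.
move=> K f [f0 [K0 fK]]; split; first by rewrite /= h0.
split=> [|x y]; first exact: mulr_ge0.
by rewrite (le_trans (fK _ _))// [L * K]mulrC -mulrA ler_wpM2l.
Qed.

(** Composition with r extends functions from N to M, and composition with i restricts them back. *)
Lemma retract_complemented (R : realType) (M N : metricType R)
    (x0 : M) (y0 : N) (i : N -> M) (r : M -> N) :
  lipschitz_map i -> lipschitz_map r -> i y0 = x0 -> cancel i r ->
  complemented (lip_fspace y0) (lip_fspace x0).
Proof.
move=> iL rL i0 ir; exists (fun f => f \o r), (fun f => f \o i); split.
- by apply: lipschitz_map_operator => //; rewrite -i0.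
- exact: lipschitz_map_operator.
- by move=> K f _; apply/funext => y /=; rewrite ir.
Qed.

(** * The wedge of countably many copies of l_infty inside l_infty *)

Section wedge.
Context {R : realType}.
Local Notation Y := (ell_infty R).
Implicit Types (x y : Y) (n m j k : nat).

(** An index that does not decode is put in block 0, at position 0. There [block_embed 0 y] merely
    repeats the entry y 0, and the other embeddings vanish. *)
Definition block_decode j : nat * nat := odflt (0%N, 0%N) (unpickle j).
Definition block_code n k : nat := pickle (n, k).

Lemma block_codeK n k : block_decode (block_code n k) = (n, k).
Proof. by rewrite /block_decode /block_code pickleK. Qed.

Fact block_embed_subproof n y :
  (fun j => if (block_decode j).1 == n then y (block_decode j).2 else 0)
    \in @ell_infty_pred R.
Proof.
apply/asboolP; exists `|y| => j _; case: ifP => _; last by rewrite normr0.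
exact: ell_infty_coord.
Qed.

Definition block_embed n y : Y := EllInfty (block_embed_subproof n y).

Definition off_block n x : R :=
  sup_norm [set j | (block_decode j).1 != n] (x : nat -> R).

Lemma bounded_off_block n x :
  bounded_over [set j | (block_decode j).1 != n] (x : nat -> R).
Proof. by exists `|x| => j _; exact: ell_infty_coord. Qed.

Lemma off_block_ge0 n x : 0 <= off_block n x.
Proof. exact: sup_norm_ge0. Qed.

Fact block_retract_subproof n x :
  (fun k => soft (off_block n x) (x (block_code n k))) \in @ell_infty_pred R.
Proof.
apply/asboolP; exists `|x| => k _.
by rewrite (le_trans (soft_norm_le _ (off_block_ge0 _ _)))// ell_infty_coord.
Qed.

(* Soft thresholding by the norm of the other blocks leaves at most one block
   nonzero, so that these maps retract onto the union of the block subspaces. *)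
Definition block_retract n x : Y := EllInfty (block_retract_subproof n x).

Lemma block_embed_dist n x y : `|block_embed n x - block_embed n y| <= `|x - y|.
Proof.
apply: ell_infty_dist_le => // j /=; case: ifP => _.
  exact: ell_infty_coordB.
by rewrite subrr normr0.
Qed.

Lemma block_retract_dist n x y :
  `|block_retract n x - block_retract n y| <= 2 * `|x - y|.
Proof.
apply: ell_infty_dist_le => [|k /=]; first exact: mulr_ge0.
rewrite (le_trans (soft_dist _ _ _ _)) ?off_block_ge0//.
rewrite mulr_natl mulr2n lerD ?ell_infty_coordB//.
apply: sup_norm_dist => //; try exact: bounded_off_block.
by move=> j _; exact: ell_infty_coordB.
Qed.

Lemma block_retract0 n : block_retract n 0 = 0.
Proof.
by apply/val_inj/funext => k /=; rewrite soft_eq0// normr0 off_block_ge0.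
Qed.

Lemma block_embed0 n : block_embed n 0 = 0.
Proof. by apply/val_inj/funext => j /=; case: ifP. Qed.

Lemma block_embedK n : cancel (block_embed n) (block_retract n).
Proof.
move=> y; apply/val_inj/funext => k /=; rewrite block_codeK eqxx /=.
suff -> : off_block n (block_embed n y) = 0 by rewrite soft0.
apply/eqP; rewrite eq_le off_block_ge0 andbT; apply: sup_norm_le => // j /=.
by move=> /negPf ->; rewrite normr0.
Qed.

(** A nonzero retract on block n provides an entry of block n larger than every entry outside it.
    Two distinct such blocks would each have an entry exceeding the other's. *)
Lemma block_retract_uniq n m x :
  block_retract n x != 0 -> block_retract m x != 0 -> n = m.
Proof.
have H p : block_retract p x != 0 ->
    exists k, off_block p x < `|x (block_code p k)|.
  apply: contraNP => /forallNP xp; apply/eqP/val_inj/funext => k /=.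
  by rewrite soft_eq0// leNgt; apply/negP; exact: xp.
move=> /H[k nk] /H[l ml]; apply/eqP/negPn/negP => nm.
have nm_le := sup_norm_ub (x := block_code m l) (bounded_off_block n x).
have mn_le := sup_norm_ub (x := block_code n k) (bounded_off_block m x).
rewrite /= !block_codeK /= in nm_le mn_le.
have := lt_le_trans nk (mn_le nm); rewrite eq_sym in nm.
move=> /lt_trans/(_ ml)/lt_le_trans/(_ (nm_le nm)).
by rewrite ltxx.
Qed.

Lemma fcountable_sum_ell_infty :
  complemented (fcountable_sum (lip_fspace (0 : Y))) (lip_fspace (0 : Y)).
Proof.
(* b x is the only active block of x. If there is none, the default 0 is harmless, since x then
   retracts to 0 in every block and every slice of f vanishes at 0. *)
pose b x := xget 0%N [set n | block_retract n x != 0].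
have bP n x : block_retract n x != 0 -> b x = n.
  by move=> xn; apply: xget_unique => // m xm; exact: block_retract_uniq xm xn.
have bN n x : b x != n -> block_retract n x = 0.
  by move=> xn; apply/eqP; apply: contraNT xn => /bP ->.
exists (fun f => f \o fun x => (b x, block_retract (b x) x)).
exists (fun g => g \o fun z => block_embed z.1 z.2); split.
- apply: (@operator_reindex _ (fcountable_sum (lip_fspace (0 : Y)))
    (lip_fspace (0 : Y)) _ 4) => // K f fK.
  have [_ [K0 _]] := fK 0%N.
  have fK2 n x y : `|f (n, block_retract n x) - f (n, block_retract n y)| <=
      2 * K * mdist x y.
    have [_ [_ fn]] := fK n; rewrite (le_trans (fn _ _))// [2 * K]mulrC -mulrA.
    by rewrite ler_wpM2l// block_retract_dist.
  split; first by rewrite /= block_retract0; have [] := fK (b 0).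
  split=> [|x y /=]; first exact: mulr_ge0.
  have [bxy|bxy] := eqVneq (b x) (b y).
    rewrite bxy (le_trans (fK2 _ _ _))// ler_wpM2r ?mdist_ge0// ler_wpM2r//.
    by rewrite ler_nat.
  (* The active blocks differ, so y retracts to 0 in the block of x, and x in that of y. Each of the
     two values is thus at most [2 * K * mdist x y], whence the constant 4. *)
  have fx := fK2 (b x) x y; have fy := fK2 (b y) x y.
  rewrite (bN (b x) y) 1?eq_sym// (fK (b x)).1 subr0 in fx.
  rewrite (bN (b y) x)// (fK (b y)).1 sub0r normrN in fy.
  by rewrite (le_trans (ler_normB _ _))//; lra.
- apply: (@operator_reindex _ (lip_fspace (0 : Y))
    (fcountable_sum (lip_fspace (0 : Y))) _ 1) => // K f [f0 [K0 fK]] n.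
  rewrite mul1r; split; first by rewrite /= block_embed0.
  split=> // x y; rewrite (le_trans (fK _ _))// ler_wpM2l//.
  exact: block_embed_dist.
- move=> K f fK; apply/funext => -[n y] /=.
  (* At the origin b need not return n, but all slices of f agree there. *)
  have [->|y0] := eqVneq y 0.
    by rewrite block_embed0 block_retract0 (fK _).1 (fK n).1.
  have yn : block_retract n (block_embed n y) != 0 by rewrite block_embedK.
  by rewrite (bP _ _ yn) block_embedK.
Qed.

End wedge.

(** * A single copy of l_infty as a retract of the c0-sum *)

Section summand.
Context {R : realType} {I : Type} (t0 : I).
Local Notation Y := (ell_infty R).
Local Notation Z := (c0_sum I Y).

Fact c0_single_subproof (y : Y) :
  (fun t => if `[< t = t0 >] then y else 0) \in @c0_sum_pred R I Y.
Proof.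
apply/asboolP => e e0; apply: (sub_finite_set (B := [set t0])) => // t /=.
by case: asboolP => // _; rewrite normr0 leNgt e0.
Qed.

Definition c0_single y : Z := C0Sum (c0_single_subproof y).

Lemma ell_infty_complemented_c0_sum :
  complemented (lip_fspace (0 : Y)) (lip_fspace (0 : Z)).
Proof.
apply: (@retract_complemented _ Z Y 0 0 c0_single (fun z => z t0)).
- exists 1 => // x y; rewrite mul1r.
  apply: c0_sum_dist_le => [|t /=]; first exact: mdist_ge0.
  by case: asboolP => // _; rewrite subrr normr0 mdist_ge0.
- by exists 1 => // x y; rewrite mul1r; exact: c0_sum_coordB.
- by apply/val_inj/funext => t /=; case: asboolP.
- by move=> y /=; case: asboolP.
Qed.

End summand.

(** * Retraction onto a bi-Lipschitz copy of the c0-sum *)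

Section absolute_retract.
Context {R : realType} {I : Type} {N : metricType R}.
Local Notation Z := (c0_sum I (ell_infty R)).
Variables (i : Z -> N) (C : R).
Hypotheses (C0 : 0 <= C) (iC : forall z z', `|z - z'| <= C * mdist (i z) (i z')).

Let coord_lip t n (z z' : Z) : z t n - z' t n <= C * mdist (i z) (i z').
Proof.
rewrite (le_trans (ler_norm _))// (le_trans (ell_infty_coordB _ _ _))//.
by rewrite (le_trans (c0_sum_coordB _ _ _)).
Qed.

Let zero_lip (z z' : Z) : 0 - 0 <= C * mdist (i z) (i z').
Proof. by rewrite subrr mulr_ge0// mdist_ge0. Qed.

Let E t n := mcshane i (fun z : Z => z t n) C.
Let D := mcshane i (fun=> 0) C.

Let D_ge0 y : 0 <= D y.
Proof.
apply: lb_le_inf; first by exists (0 + C * mdist y (i 0)), 0.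
by move=> _ [z _ <-]; rewrite add0r mulr_ge0// mdist_ge0.
Qed.

Let E_lip t n y y' : `|E t n y - E t n y'| <= C * mdist y y'.
Proof. exact: (mcshane_lipschitz 0 C0 (coord_lip t n)). Qed.

Let Ei t n z : E t n (i z) = z t n.
Proof. exact: (mcshane_extends 0 C0 (coord_lip t n)). Qed.

Fact threshold_ell_infty_subproof y t :
  (fun n => soft (D y) (E t n y)) \in @ell_infty_pred R.
Proof.
(* The bound, uniform in n, comes from comparison with the point i 0, where every E t n vanishes. *)
apply/asboolP; exists (C * mdist y (i 0)) => n _.
rewrite (le_trans (soft_norm_le _ (D_ge0 _)))//.
by have := E_lip t n y (i 0); rewrite Ei subr0.
Qed.

Let threshold_coord y t : ell_infty R :=
  EllInfty (threshold_ell_infty_subproof y t).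

(* D bounds C times the distance to the image of i, hence the distance from
   the family of the E t n y to c0: thresholding at D y lands in the c0-sum. *)
Fact threshold_c0_sum_subproof y :
  threshold_coord y \in @c0_sum_pred R I (ell_infty R).
Proof.
apply/asboolP => e e0; have e20 : 0 < e / 2 by rewrite divr_gt0.
(* For z with i z almost nearest to y, each E t n y lies within D y + e / 2 of z t n. After
   thresholding, only the finitely many t with [|z t|] >= e / 2 can keep norm e. *)
have [z zy] := mcshane_adherent 0 C0 zero_lip y e20.
rewrite add0r -/(D y) in zy.
apply: (sub_finite_set _ (c0_sumP z e20)) => t /= et.
rewrite leNgt; apply/negP => zt; move: et; apply/negP; rewrite -ltNge.
rewrite (@le_lt_trans _ _ (e / 2 + `|z t|))//; last by lra.
have zt0 : 0 <= `|z t| by [].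
apply: ell_infty_norm_le => [|n /=]; first by lra.
apply: soft_le => //; first by lra.
rewrite -[E t n y](subrK (E t n (i z))) (le_trans (ler_normD _ _))//.
rewrite addrA lerD//; last by rewrite Ei ell_infty_coord.
by rewrite (le_trans (E_lip _ _ _ _))// ltW.
Qed.

Definition threshold y : Z := C0Sum (threshold_c0_sum_subproof y).

Lemma thresholdK : cancel i threshold.
Proof.
move=> z; apply/val_inj/funext => t; apply/val_inj/funext => n /=.
by rewrite Ei /D (mcshane_extends 0 C0 zero_lip) soft0.
Qed.

(** The extended coordinates and the threshold D contribute C each. *)
Lemma threshold_lipschitz : lipschitz_map threshold.
Proof.
exists (2 * C) => [|x y]; first exact: mulr_ge0.
have CM0 : 0 <= 2 * C * mdist x y by rewrite !mulr_ge0// mdist_ge0.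
apply: c0_sum_dist_le => // t; apply: ell_infty_dist_le => // n /=.
rewrite (le_trans (soft_dist _ _ _ _)) ?D_ge0//.
rewrite -mulrA mulr_natl mulr2n lerD//.
exact: (mcshane_lipschitz 0 C0 zero_lip).
Qed.

End absolute_retract.

(** * Cylinders of Cantor space and the embedding of the c0-sum in l_infty *)

Definition cylinder (u : seq bool) : set (nat -> bool) :=
  [set t | mkseq t (size u) = u].

(** Each s in A other than t differs from t at some index d s; finitely many such indices lie below
    one length m, and the prefix of t of length m works. *)
Lemma isolating_cylinder (A : set (nat -> bool)) t : finite_set A ->
  exists2 u, cylinder u t & forall s, cylinder u s -> A s -> s = t.
Proof.
move=> Afin.
have /choice[d dP] : forall s : nat -> bool, exists n, s <> t -> s n <> t n.
  move=> s; have [->|st] := pselect (s = t); first by exists 0%N.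
  have /existsNP[n sn] : ~ forall n, s n = t n by move=> ?; apply/st/funext.
  by exists n.
have /finite_seqP[l lE] := finite_image d Afin.
have [m lm] : exists m, forall n, n \in l -> (n < m)%N.
  by exists (\max_(n <- l) n).+1 => n nl; rewrite ltnS leq_bigmax_seq.
exists (mkseq t m); first by rewrite /cylinder /mkset size_mkseq.
move=> s; rewrite /cylinder /mkset size_mkseq => st As.
apply: contrapT => /dP; apply.
have ds : d s \in l by have : [set d s | s in A] (d s) by [exists s]; rewrite lE.
by have := congr1 (nth false ^~ (d s)) st; rewrite !nth_mkseq// lm.
Qed.

Section embedding.
Context {R : realType}.
Local Notation Y := (ell_infty R).
Local Notation Z := (c0_sum (nat -> bool) Y).
Implicit Types (z : Z) (b : bool) (a c : R).

(** Absolute values alone would not distinguish a from -a, so the positive and negative parts are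
    recorded separately. *)
Definition part b a : R := Num.max (if b then a else - a) 0.

Lemma part_dist b a c : `|part b a - part b c| <= `|a - c|.
Proof.
have ac : a - c <= `|a - c| by exact: ler_norm.
have ca : c - a <= `|a - c| by rewrite distrC ler_norm.
rewrite ler_norml /part; apply/andP.
by case: b; [case: (leP a 0) => ?; case: (leP c 0) => ?|
  case: (leP (- a) 0) => ?; case: (leP (- c) 0) => ?]; split; lra.
Qed.

Lemma part0 b : part b 0 = 0.
Proof. by rewrite /part; case: b; rewrite ?oppr0 maxxx. Qed.

Lemma part_norm_le b a : `|part b a| <= `|a|.
Proof. by have := part_dist b a 0; rewrite part0 !subr0. Qed.

Lemma bounded_part S b k z : bounded_over S (fun t => part b (z t k) : R).
Proof.
exists `|z| => t _; rewrite (le_trans (part_norm_le _ _))//.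
by rewrite (le_trans (ell_infty_coord _ _))// c0_sum_coord.
Qed.

(** Since [part] is nonnegative, this is the plain supremum of the signed parts over the
    cylinder. *)
Definition cylinder_sup u b k z : R :=
  sup_norm (cylinder u) (fun t => part b (z t k) : R).

Lemma cylinder_sup_dist u b k z z' :
  `|cylinder_sup u b k z - cylinder_sup u b k z'| <= `|z - z'|.
Proof.
apply: sup_norm_dist => //; try exact: bounded_part.
move=> t _; rewrite (le_trans (part_dist _ _ _))//.
by rewrite (le_trans (ell_infty_coordB _ _ _))// c0_sum_coordB.
Qed.

Lemma cylinder_sup0 u b k : cylinder_sup u b k 0 = 0.
Proof.
apply/eqP; rewrite eq_le sup_norm_ge0 andbT; apply: sup_norm_le => // t _.
by rewrite part0 normr0.
Qed.

Definition cylinder_decode (n : nat) : seq bool * bool * nat :=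
  odflt ([::], true, 0%N) (unpickle n).

Fact cylinder_embed_subproof z :
  (fun n => let: (u, b, k) := cylinder_decode n in cylinder_sup u b k z)
    \in @ell_infty_pred R.
Proof.
apply/asboolP; exists `|z| => n _; case: (cylinder_decode n) => -[u b] k.
by have := cylinder_sup_dist u b k z 0; rewrite cylinder_sup0 !subr0.
Qed.

Definition cylinder_embed z : Y := EllInfty (cylinder_embed_subproof z).

Lemma cylinder_embed0 : cylinder_embed 0 = 0.
Proof.
apply/val_inj/funext => n /=; case: (cylinder_decode n) => -[u b] k.
exact: cylinder_sup0.
Qed.

Lemma cylinder_embed_dist z z' :
  `|cylinder_embed z - cylinder_embed z'| <= `|z - z'|.
Proof.
apply: ell_infty_dist_le => // n /=; case: (cylinder_decode n) => -[u b] k.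
exact: cylinder_sup_dist.
Qed.

Lemma cylinder_sup_embed u b k z z' :
  cylinder_sup u b k z - cylinder_sup u b k z' <=
  `|cylinder_embed z - cylinder_embed z'|.
Proof.
rewrite (le_trans (ler_norm _))//.
have := ell_infty_coordB (cylinder_embed z) (cylinder_embed z')
  (pickle (u, b, k)).
by rewrite /= /cylinder_decode pickleK.
Qed.

(* A cylinder isolating t from the other big coordinates of z' separates z from
   z' once the sign b is chosen so that [part b (z t k) = `|z t k|]. *)
Lemma cylinder_embed_coord z z' t k e : 0 < e -> `|z' t k| <= `|z t k| ->
  `|z t k - z' t k| <= 2 * (`|cylinder_embed z - cylinder_embed z'| + e).
Proof.
move=> e0 zz'; have [u ut uP] := isolating_cylinder t (c0_sumP z' e0).
pose b := 0 <= z t k.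
have H := cylinder_sup_embed u b k z z'.
have Hz : part b (z t k) <= cylinder_sup u b k z.
  rewrite (le_trans (ler_norm _))//.
  by apply: (sup_norm_ub (bounded_part (cylinder u) b k z)).
(* On the isolating cylinder every coordinate of z' other than t has norm below e. *)
have Hz' : cylinder_sup u b k z' <= Num.max (part b (z' t k)) e.
  apply: sup_norm_le => [|s us]; first by rewrite le_max (ltW e0) orbT.
  rewrite le_max; have [es|es] := leP e `|z' s|.
    rewrite (uP s us es) ger0_norm ?lexx// /part le_max lexx orbT//.
  apply/orP; right; rewrite (le_trans (part_norm_le _ _))//.
  by rewrite (le_trans (ell_infty_coord _ _))// ltW.
have d0 : 0 <= `|cylinder_embed z - cylinder_embed z'| by [].
move: d0 zz' H Hz Hz'; rewrite /part {}/b.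
move: (cylinder_sup _ _ _ _) (cylinder_sup _ _ _ _) => F G.
move: `|cylinder_embed z - _| (z t k) (z' t k) => d a c d0.
rewrite [`|a - c| <= _]ler_norml ge_max !le_max ler_norml.
(* Here [|a|] <= d + G and [|c|] <= [|a|]. If G is at most c with the sign of a, then [|a - c|] <=
   d; otherwise G <= e, so [|a|] <= d + e and [|a - c|] <= 2 [|a|], whence the factor 2. *)
case: (ger0P a) => a0 /andP[ca1 ca2] FG /andP[aG _] /orP[/orP[]|] GF;
  by apply/andP; split; lra.
Qed.

Lemma cylinder_embed_lower z z' :
  `|z - z'| <= 2 * `|cylinder_embed z - cylinder_embed z'|.
Proof.
have d0 : 0 <= 2 * `|cylinder_embed z - cylinder_embed z'| by exact: mulr_ge0.
apply: c0_sum_dist_le => // t; apply: ell_infty_dist_le => // k.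
apply/ler_addgt0Pr => e e0; have e20 : 0 < e / 2 by rewrite divr_gt0.
have -> : 2 * `|cylinder_embed z - cylinder_embed z'| + e =
    2 * (`|cylinder_embed z - cylinder_embed z'| + e / 2) by field.
(* Both sides are symmetric in z and z', so the larger coordinate may be taken to be that of z. *)
have [|/ltW] := leP `|z' t k| `|z t k|; first exact: cylinder_embed_coord.
by rewrite distrC [X in 2 * (X + _)]distrC; exact: cylinder_embed_coord.
Qed.

Lemma c0_sum_complemented_ell_infty :
  complemented (lip_fspace (0 : Z)) (lip_fspace (0 : Y)).
Proof.
have C0 : 0 <= 2 :> R by [].
apply: (@retract_complemented _ Y Z 0 0 cylinder_embed
  (@threshold R _ Y cylinder_embed 2 C0 cylinder_embed_lower)).
- by exists 1 => // x y; rewrite mul1r; exact: cylinder_embed_dist.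
- exact: threshold_lipschitz.
- exact: cylinder_embed0.
- exact: thresholdK.
Qed.

End embedding.

Theorem theorem29 (R : realType) :
  linearly_isomorphic
    (free_space (0 : c0_sum (nat -> bool) (ell_infty R)))
    (free_space (0 : ell_infty R)).
Proof.
apply/fiso_free_space/pelczynski_decomposition.
- exact: fcountable_sum_ell_infty.
- exact: c0_sum_complemented_ell_infty.
- exact: (ell_infty_complemented_c0_sum (fun=> true)).
Qed.
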